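(* Let $K$ be an arbitrary field, let $I\subset R:=K[x_1,\ldots,x_n]$ be an ideal generated by monomials of degree two, with graded Betti numbers $\beta_{i,j}$, let $m$ be the Castelnuovo–Mumford regularity of $I$, and let $p$ be the length of the minimal graded free resolution of $I$. For all $d\geq 3$, set $i_d:=\min_{1\leq i\leq p}\{i:\ \beta_{i,i+d}\neq 0\}$ if $\beta_{i,i+d}\neq 0$ for some $i\geq 1$, and $i_d:=0$ otherwise. If $I$ does not have a linear resolution, then $$1\leq i_3<\cdots<i_m\leq p.$$
   Context: $R$ has its standard grading. The minimal graded free resolution of $I$ is written $0\to\bigoplus_j R(-j)^{\beta_{p,j}}\to\cdots\to\bigoplus_j R(-j)^{\beta_{0,j}}\to I\to 0$; the resolution is of $I$ (not of $R/I$), so $\beta_{0,j}$ counts minimal generators of degree $j$. The Castelnuovo–Mumford regularity of $I$ is $m=\max\{j:\ \beta_{i,i+j}\neq0\text{ for some }i\}$. $I$ has a linear resolution if $\beta_{i,j}=0$ whenever $j\neq i+2$. *)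

(* Defs.v *)
From mathcomp Require Import all_boot all_order all_algebra.
From mathcomp.multinomials Require Export mpoly.

Set Implicit Arguments.
Unset Strict Implicit.
Unset Printing Implicit Defensive.

Import GRing.Theory.
Local Open Scope ring_scope.

Definition ideal_gen (R : comNzRingType) (s : seq R) (f : R) : Prop :=
  exists c : 'I_(size s) -> R, f = \sum_(i < size s) c i * s`_i.

(* A finite list of monomials loses no generality: there are only finitely many
   monomials of degree two in n variables. *)
Definition generated_by_quadratic_monomials (K : fieldType) (n : nat)
    (I : {mpoly K[n]} -> Prop) : Prop :=
  exists2 S : seq 'X_{1..n}, (forall u, u \in S -> mdeg u = 2%N) &
    forall f, I f <-> ideal_gen [seq 'X_[K, u] | u <- S] f.

(* Multiplication by f is a degree-preserving map R(-e) -> R(-d), i.e. f is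
   homogeneous of degree e - d (and f = 0 when e < d). *)
Definition graded_entry (K : fieldType) (n : nat) (e d : nat)
    (f : {mpoly K[n]}) : bool :=
  if (d <= e)%N then f \is (e - d)%N.-homog else f == 0.

(* F_i = \bigoplus_(a < gfr_rank i) R(- gfr_shift i a); its elements are row
   vectors, and maps act by multiplication on the right. Natural shifts suffice:
   I lives in nonnegative degrees, hence so do the generators of every module in
   its minimal resolution. *)
Record graded_free_resolution (K : fieldType) (n : nat)
    (I : {mpoly K[n]} -> Prop) := GradedFreeResolution {
  gfr_rank : nat -> nat;
  gfr_shift : forall i, 'I_(gfr_rank i) -> nat;
  gfr_aug : 'cV[{mpoly K[n]}]_(gfr_rank 0);
  gfr_diff : forall i, 'M[{mpoly K[n]}]_(gfr_rank i.+1, gfr_rank i);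
  gfr_aug_graded : forall a, gfr_aug a ord0 \is (gfr_shift a).-homog;
  gfr_diff_graded : forall i a b,
    graded_entry (gfr_shift a) (gfr_shift b) (gfr_diff i a b);
  gfr_aug_image : forall f,
    I f <-> exists v : 'rV_(gfr_rank 0), f = (v *m gfr_aug) ord0 ord0;
  gfr_exact0 : forall v : 'rV_(gfr_rank 0),
    v *m gfr_aug = 0 <-> exists w : 'rV_(gfr_rank 1), v = w *m gfr_diff 0;
  gfr_exactS : forall i (v : 'rV_(gfr_rank i.+1)),
    v *m gfr_diff i = 0 <->
    exists w : 'rV_(gfr_rank i.+2), v = w *m gfr_diff i.+1
}.

Section Invariants.

Variables (K : fieldType) (n : nat) (I : {mpoly K[n]} -> Prop).
Variable F : graded_free_resolution I.

(* The image of F_(i+1) lies in (x_1, ..., x_n) F_i. *)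
Definition minimal_resolution : Prop :=
  forall i a b, (gfr_diff F i a b)@_(0%MM) = 0.

Definition betti (i j : nat) : nat :=
  #|[pred a : 'I_(gfr_rank F i) | gfr_shift a == j]|.

Definition resolution_length (p : nat) : Prop :=
  gfr_rank F p <> 0%N /\ forall i, (p < i)%N -> gfr_rank F i = 0%N.

Definition castelnuovo_mumford_regularity (m : nat) : Prop :=
  (exists i, betti i (i + m) <> 0%N) /\
  (forall i j, betti i (i + j) <> 0%N -> (j <= m)%N).

Definition linear_resolution : Prop :=
  forall i j, j <> (i + 2)%N -> betti i j = 0%N.

(* The least i in {1, ..., p} with betti i (i + d) != 0, and 0 if there is
   none: the filtered list is increasing. *)
Definition first_index (p d : nat) : nat :=
  head 0%N [seq i <- iota 1 p | betti i (i + d) != 0%N].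

End Invariants.

(* Main.v *)
From HB Require Import structures.
Require Import Defs.
From mathcomp Require Import all_boot all_order all_algebra.
From mathcomp Require Import zify ring.
From Stdlib Require Import Classical.

Set Implicit Arguments.
Unset Strict Implicit.
Unset Printing Implicit Defensive.

Import GRing.Theory.
Local Open Scope ring_scope.

(* The graded Betti numbers of I are read off the Koszul homology of R/I, which for a
   monomial ideal splits into strands indexed by exponent vectors b: beta_{i,j}(I) != 0
   iff some b with |b| = j carries a nonzero class in homological degree k = i + 1.
   Take b of minimal degree carrying a class with |b| - k = r + 1 and a variable x_v
   dividing x^b.  By minimality the e_v-part of the class is a boundary, so the class is
   x_v times a nonzero class y of R/(I : x_v) in degree b - e_v.  Since I is generated by
   quadrics, I : x_v is I plus the variables x_u with x_u x_v in I.  Such an x_u dividing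
   x^(b - e_v) can only occur in y through a factor e_u, and stripping it lowers |b| and k
   by one; at least one must occur, as otherwise the strand of b is a cone with apex v.
   After all of them are stripped one has a class of R/I with |b'| - k' = r and k' < k.
   Hence the least homological degree strictly increases with r. *)

(** * Interior and exterior multiplication on Koszul chains *)

Section KoszulOperators.

Variables (n : nat) (R : comNzRingType) (V : lmodType R).
Local Notation chain := {ffun {set 'I_n} -> V}.
Implicit Types (u v s : 'I_n) (S : {set 'I_n}) (z w : chain) (a : 'I_n -> R).

(** A chain [z] stands for the sum of the [z S *: e_S], the factors of [e_S] being in increasing
    order; this is the sign of moving [e_v] to its place. *)
Definition ksign v S : bool := odd #|[set t in S | (t < v)%N]|.

Definition contract v z : chain :=
  [ffun S : {set 'I_n} => if v \in S then 0 else (-1) ^+ ksign v S *: z (v |: S)].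

Definition wedge v z : chain :=
  [ffun S : {set 'I_n} => if v \in S then (-1) ^+ ksign v S *: z (S :\ v) else 0].

(** The Koszul differential that sends [e_s] to [a s]. *)
Definition koszul a z : chain := \sum_s a s *: contract s z.

Lemma ksignU u v S : u \notin S ->
  ksign v (u |: S) = (u < v)%N (+) ksign v S.
Proof.
move=> uS; rewrite /ksign.
have -> : [set t in u |: S | (t < v)%N] =
    if (u < v)%N then u |: [set t in S | (t < v)%N] else [set t in S | (t < v)%N].
  apply/setP=> t; rewrite !inE; case: ifP => uv; rewrite !inE.
    by case: eqP => [->|] //=; rewrite uv.
  by case: eqP => [->|] //=; rewrite uv andbF.
case: ifP => uv //.
by rewrite cardsU1 inE (negbTE uS) /= oddD.
Qed.

Lemma ksignU1 v S : ksign v (v |: S) = ksign v S.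
Proof.
rewrite /ksign; congr (odd #|pred_of_set _|); apply/setP=> t; rewrite !inE.
by case: eqP => [->|] //=; rewrite ltnn andbF.
Qed.

Lemma ksignD1 v S : ksign v (S :\ v) = ksign v S.
Proof.
rewrite /ksign; congr (odd #|pred_of_set _|); apply/setP=> t; rewrite !inE.
by case: eqP => [->|] //=; rewrite ltnn andbF.
Qed.

Lemma contract_is_linear v : linear (contract v).
Proof.
move=> c z w; apply/ffunP=> S; rewrite !ffunE; case: ifP => _.
  by rewrite scaler0 addr0.
by rewrite scalerDr !scalerA mulrC.
Qed.

HB.instance Definition _ v := GRing.isLinear.Build R chain chain _ (contract v)
  (contract_is_linear v).

Lemma wedge_is_linear v : linear (wedge v).
Proof.
move=> c z w; apply/ffunP=> S; rewrite !ffunE; case: ifP => _.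
  by rewrite scalerDr !scalerA mulrC.
by rewrite scaler0 addr0.
Qed.

HB.instance Definition _ v := GRing.isLinear.Build R chain chain _ (wedge v)
  (wedge_is_linear v).

Lemma koszul_is_linear a : linear (koszul a).
Proof.
move=> c z w; rewrite /koszul scaler_sumr -big_split /=; apply: eq_bigr => s _.
by rewrite linearP scalerDr !scalerA mulrC.
Qed.

HB.instance Definition _ a := GRing.isLinear.Build R chain chain _ (koszul a)
  (koszul_is_linear a).

Lemma contractxx v z : contract v (contract v z) = 0.
Proof.
by apply/ffunP=> S; rewrite !ffunE setU11 scaler0 if_same.
Qed.

Lemma contractC u v z : contract u (contract v z) = - contract v (contract u z).
Proof.
have [->|uv] := eqVneq u v; first by rewrite contractxx oppr0.
apply/ffunP=> S; rewrite !ffunE !inE [v == u]eq_sym (negbTE uv) /=.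
case: ifP => uS; case: ifP => vS; rewrite ?scaler0 ?oppr0 //.
rewrite !scalerA -scaleNr setUCA; congr (_ *: _).
rewrite !ksignU ?uS ?vS // !signr_addb.
have : (u < v)%N = ~~ (v < u)%N by case: ltngtP uv => // /val_inj ->; rewrite eqxx.
by move=> ->; case: (v < u)%N; rewrite /= ?expr0 ?expr1; ring.
Qed.

Lemma wedge_contract v z : wedge v (contract v z) + contract v (wedge v z) = z.
Proof.
apply/ffunP=> S; rewrite !ffunE; case: ifP => vS.
  rewrite !inE eqxx /= addr0 scalerA ksignD1 -signr_addb addbb expr0 scale1r.
  by rewrite setD1K.
by rewrite setU11 add0r scalerA ksignU1 -signr_addb addbb expr0 scale1r setU1K ?vS.
Qed.

Lemma contract_wedge u v z : u != v ->
  contract u (wedge v z) = - wedge v (contract u z).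
Proof.
move=> uv; apply/ffunP=> S; rewrite !ffunE !inE [v == u]eq_sym (negbTE uv) /=.
case: ifP => uS; case: ifP => vS; rewrite ?scaler0 ?oppr0 //.
have [T vT eS] : exists2 T : {set 'I_n}, v \notin T & S = v |: T.
  by exists (S :\ v); rewrite ?setD1K // !inE eqxx.
subst S; have uT : u \notin T by move/negbT: uS; rewrite !inE negb_or => /andP[].
rewrite !scalerA -scaleNr setUCA !setU1K ?inE ?negb_or 1?eq_sym ?uv //.
congr (_ *: _); rewrite !ksignU1 !ksignU ?inE ?negb_or ?uv // !signr_addb.
have : (u < v)%N = ~~ (v < u)%N by case: ltngtP uv => // /val_inj ->; rewrite eqxx.
by move=> ->; case: (v < u)%N; rewrite /= ?expr0 ?expr1; ring.
Qed.

Lemma koszulE a z S :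
  koszul a z S = \sum_(s | s \notin S) (a s * (-1) ^+ ksign s S) *: z (s |: S).
Proof.
rewrite /koszul sum_ffunE [RHS]big_mkcond /=; apply: eq_bigr => s _.
by rewrite !ffunE; case: ifP => _; rewrite ?scaler0 ?scalerA.
Qed.

Lemma contract_koszul a v z : contract v (koszul a z) = - koszul a (contract v z).
Proof.
rewrite /koszul linear_sum -sumrN; apply: eq_bigr => s _ /=.
by rewrite linearZ /= contractC scalerN.
Qed.

Lemma koszul_koszul a z : koszul a (koszul a z) = 0.
Proof.
have -> : koszul a (koszul a z) =
    \sum_i \sum_j (a i * a j) *: contract i (contract j z).
  apply: eq_bigr => i _; rewrite /koszul linear_sum scaler_sumr.
  by apply: eq_bigr => j _; rewrite linearZ /= scalerA.
pose F i j : chain := (a i * a j) *: contract i (contract j z).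
have FN i j : F i j = - F j i by rewrite /F contractC mulrC scalerN.
(* The diagonal is treated apart, since in characteristic two [FN] does not make it vanish. *)
have F0 i : F i i = 0 by rewrite /F contractxx scaler0.
have -> : \sum_i \sum_j F i j =
    \sum_(i < n) \sum_(j < n | (i < j)%N) F i j +
    \sum_(i < n) \sum_(j < n | (j < i)%N) F i j.
  rewrite -big_split; apply: eq_bigr => i _ /=.
  rewrite (bigID (fun j : 'I_n => (i < j)%N)) /=; congr (_ + _).
  rewrite (bigD1 i) ?ltnn //= F0 add0r; apply: eq_bigl => j.
  by rewrite -leqNgt ltn_neqAle andbC.
rewrite [X in _ + X](exchange_big_dep xpredT) //= -big_split big1 //= => i _.
by rewrite -big_split big1 //= => j _; rewrite FN addNr.
Qed.

(** Exterior multiplication by [e_v] is a homotopy between multiplication by [a v] and zero. The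
    cone argument and the exactness of the Koszul complex both rest on it. *)
Lemma koszul_wedge a v z :
  koszul a (wedge v z) = a v *: z - wedge v (koszul a z).
Proof.
rewrite /koszul linear_sum (bigD1 v) //= [X in _ - X](bigD1 v) //= linearZ /=.
have -> : contract v (wedge v z) = z - wedge v (contract v z).
  by rewrite -{2}(wedge_contract v z) addrAC subrr add0r.
rewrite scalerBr opprD addrA -sumrN; congr (_ - _ + _).
apply: eq_bigr => s sv.
by rewrite contract_wedge // [X in _ = - X]linearZ /= scalerN.
Qed.

End KoszulOperators.

(** * Multigraded strands of the Koszul homology of a monomial quotient *)

Section MultigradedHomology.

Variables (K : fieldType) (n : nat).
Local Notation chain := {ffun {set 'I_n} -> K^o}.
Local Notation multideg := 'X_{1..n}.
Implicit Types (u v s : 'I_n) (S : {set 'I_n}) (f g t w : chain) (b c m : multideg)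
  (mon : pred multideg).

Definition set_mnm S : multideg := [multinom nat_of_bool (i \in S) | i < n].

Definition cell mon b S : bool := (set_mnm S <= b)%MM && ~~ mon (b - set_mnm S)%MM.

(** For [S] below [b] and [s] outside [S], the factor vanishes exactly when [s |: S] is not below
    [b]. Chains can thus be functions on all sets, with no support condition. *)
Definition strand_diff b : chain -> chain := koszul (fun s => (0 < b s)%N%:R).

HB.instance Definition _ b := GRing.Linear.on (strand_diff b).

(** Only cells are tested: any other coefficient belongs to no monomial, or to one that is zero in
    the quotient. *)
Definition strand_cycle mon b f :=
  forall S, cell mon b S -> strand_diff b f S = 0.

Definition strand_boundary mon b f :=
  exists g, forall S, cell mon b S -> f S = strand_diff b g S.

(* Degree-[b] part of the [k]-th Koszul homology of the quotient of the
   polynomial ring by the monomial ideal [mon]: the value at [S] is the coefficient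
   of [x^(b - S) e_S], a monomial that is nonzero in the quotient iff [cell mon b S]. *)
Definition homology_nonzero mon k b := exists f,
  [/\ forall S, f S != 0 -> #|S| = k, strand_cycle mon b f & ~ strand_boundary mon b f].

Definition monomial_ideal mon := forall m1 m2, (m1 <= m2)%MM -> mon m1 -> mon m2.

Definition colon mon v : pred multideg := fun m => mon (m + U_(v))%MM.

Lemma le_set_mnmU s S b :
  s \notin S -> (set_mnm (s |: S) <= b)%MM = (0 < b s)%N && (set_mnm S <= b)%MM.
Proof.
move=> sS; apply/mnm_lepP/andP => [le|[bs /mnm_lepP le] i].
  split; first by have := le s; rewrite mnmE !inE eqxx.
  apply/mnm_lepP=> i; apply: leq_trans (le i); rewrite !mnmE !inE.
  by case: eqP => _; case: (i \in S).
rewrite mnmE !inE; case: eqP => [->|_] //=; have := le i; rewrite mnmE //.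
Qed.

Lemma le_set_mnm_sub v S b :
  (0 < b v)%N -> v \notin S -> (set_mnm S <= b - U_(v))%MM = (set_mnm S <= b)%MM.
Proof.
move=> bv vS; apply/mnm_lepP/mnm_lepP => le i; have := le i; rewrite !mnmE.
  by move/leq_trans; apply; rewrite leq_subr.
by case: eqP => [<-|]; rewrite ?subn0 // (negbTE vS).
Qed.

Lemma le_sub_mnm v S b : (set_mnm S <= b - U_(v))%MM -> (set_mnm S <= b)%MM.
Proof. by move/lepm_trans; apply; rewrite lem_subr. Qed.

Lemma sub_set_mnmU v S b : v \notin S ->
  (b - set_mnm (v |: S) = b - U_(v) - set_mnm S)%MM.
Proof.
move=> vS; apply/mnmP=> i; rewrite !mnmE !inE -subnDA [i == v]eq_sym.
by case: eqP => [<-|]; rewrite ?(negbTE vS).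
Qed.

Lemma sub_mnm_set v S b : (0 < b v)%N -> (set_mnm S <= b - U_(v))%MM ->
  (b - set_mnm S = b - U_(v) - set_mnm S + U_(v))%MM.
Proof.
move=> bv /mnm_lepP le; apply/mnmP=> i; have := le i; rewrite !mnmE.
by case: eqP => [<-|]; lia.
Qed.

Lemma mdeg_subU v b : (0 < b v)%N -> mdeg b = (mdeg (b - U_(v))).+1.
Proof.
move=> bv; have {1}-> : b = (b - U_(v) + U_(v))%MM.
  by rewrite submK //; apply/mnm_lepP=> i; rewrite mnmE; case: eqP => // <-.
by rewrite mdegD mdeg1 addn1.
Qed.

Lemma mdeg_set_mnm S : mdeg (set_mnm S) = #|S|.
Proof.
rewrite mdegE -sum1_card [RHS]big_mkcond /=; apply: eq_bigr => i _.
by rewrite mnmE; case: (i \in S).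
Qed.

(** Enlarging [S] replaces [x^(b - S)] by a divisor, and divisors of a monomial outside the ideal
    stay outside. *)
Lemma cellU mon b s S : monomial_ideal mon -> s \notin S -> (0 < b s)%N ->
  cell mon b S -> cell mon b (s |: S).
Proof.
move=> Hmon sS bs /andP[le nm]; rewrite /cell le_set_mnmU // bs le /=.
apply: contra nm; apply: Hmon; rewrite sub_set_mnmU //.
by apply/mnm_lepP=> i; rewrite !mnmE -subnDA addnC subnDA leq_subr.
Qed.

Lemma cell_subU mon b v S : (0 < b v)%N -> v \notin S ->
  cell mon (b - U_(v)) S = cell mon b (v |: S).
Proof.
by move=> bv vS; rewrite /cell le_set_mnmU // bv le_set_mnm_sub // sub_set_mnmU.
Qed.

Lemma strand_diffE b f S : strand_diff b f S =
  \sum_(s | s \notin S) ((0 < b s)%N%:R * (-1) ^+ ksign s S) *: f (s |: S).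
Proof. exact: koszulE. Qed.

Lemma eq_strand_diff mon b f g S : monomial_ideal mon -> cell mon b S ->
  (forall T, cell mon b T -> f T = g T) -> strand_diff b f S = strand_diff b g S.
Proof.
move=> Hmon cS fg; rewrite !strand_diffE; apply: eq_bigr => s sS.
have [bs|] := boolP (0 < b s)%N; last by rewrite !mul0r !scale0r.
by rewrite fg // cellU.
Qed.

(** The two differentials can differ only at [s = v] with [b v = 1], and then no set in the support
    of [t] contains [v]. *)
Lemma strand_diff_subU b v t :
    (forall S, t S != 0 -> (set_mnm S <= b - U_(v))%MM) ->
  strand_diff b t = strand_diff (b - U_(v)) t.
Proof.
move=> tb; apply/ffunP=> S; rewrite !strand_diffE; apply: eq_bigr => s sS.
have [->|/tb] := eqVneq (t (s |: S)) 0; first by rewrite !scaler0.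
rewrite le_set_mnmU // => /andP[bs _]; rewrite bs.
by rewrite (leq_trans bs) // mnmBE leq_subr.
Qed.

Lemma strand_diff_contract b v f : (0 < b v)%N ->
  strand_diff (b - U_(v)) (contract v f) = - contract v (strand_diff b f).
Proof.
move=> bv; rewrite [in RHS]/strand_diff contract_koszul opprK.
apply: eq_bigr => s _; have [->|sv] := eqVneq s v.
  by rewrite contractxx !scaler0.
by rewrite mnmBE mnm1E eq_sym (negbTE sv) subn0.
Qed.

Lemma strand_diff_wedge b v f : (0 < b v)%N ->
  strand_diff b (wedge v f) = f - wedge v (strand_diff b f).
Proof. by move=> bv; rewrite /strand_diff koszul_wedge bv scale1r. Qed.

(** The differential lowers the size of sets by one and, on cells, reads only sets below [b]; so a
    bounding chain can be cut down to the relevant sets. *)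
Lemma strand_boundaryP mon b f k : (forall S, f S != 0 -> #|S| = k) ->
    strand_boundary mon b f ->
  exists g, [/\ forall S, g S != 0 -> (set_mnm S <= b)%MM,
      forall S, g S != 0 -> #|S| = k.+1 &
      forall S, cell mon b S -> f S = strand_diff b g S].
Proof.
move=> fk [g fg].
exists [ffun S : {set 'I_n} => if (set_mnm S <= b)%MM && (#|S| == k.+1) then g S else 0].
split=> [S|S|S cS]; rewrite ?ffunE; try by case: ifP => [/andP[]|]; rewrite ?eqxx // => ? /eqP.
have [Sk|Sk] := eqVneq #|S| k; last first.
  have [->|/fk Sk'] := eqVneq (f S) 0; last by rewrite Sk' eqxx in Sk.
  rewrite strand_diffE big1 // => s sS; rewrite ffunE cardsU1 sS eqSS (negbTE Sk).
  by rewrite andbF scaler0.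
rewrite fg // !strand_diffE; apply: eq_bigr => s sS.
rewrite ffunE cardsU1 sS Sk eqxx andbT le_set_mnmU //.
case/andP: cS => -> _; rewrite andbT.
by case: (0 < b s)%N; rewrite // !mul0r !scale0r.
Qed.

Lemma contract_card f v k : (forall S, f S != 0 -> #|S| = k) ->
  forall S, contract v f S != 0 -> #|S|.+1 = k.
Proof.
move=> fk S; rewrite ffunE; case: ifP => vS; first by rewrite eqxx.
have [->|/fk <- _] := eqVneq (f (v |: S)) 0; first by rewrite scaler0 eqxx.
by rewrite cardsU1 vS.
Qed.

Lemma strand_cycle_contract mon b v f : (0 < b v)%N ->
  strand_cycle mon b f -> strand_cycle mon (b - U_(v)) (contract v f).
Proof.
move=> bv fb S cS; rewrite strand_diff_contract // !ffunE.
case: ifP => vS; first by rewrite oppr0.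
by rewrite fb ?scaler0 ?oppr0 // -cell_subU ?vS.
Qed.

Lemma homology_cell mon k b : homology_nonzero mon k b ->
  exists f S, [/\ cell mon b S, #|S| = k, f S != 0, strand_cycle mon b f &
    forall S, f S != 0 -> #|S| = k].
Proof.
case=> f [fk fc fb]; apply: NNPP => H; apply: fb; exists 0 => S cS.
rewrite linear0 ffunE.
have [//|nz] := eqVneq (f S) 0; case: H.
by exists f, S; split => //; apply: fk.
Qed.

(** If [w] bounds the [e_v]-part of [f], then adding the boundary of [wedge v w] to [f] makes every
    coefficient on a cell divisible by [x_v]. Dividing by [x_v] gives the class in the colon
    quotient. *)
Lemma homology_colon mon k b v : monomial_ideal mon -> (0 < b v)%N ->
    (0 < k -> ~ homology_nonzero mon k.-1 (b - U_(v)))%N ->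
  homology_nonzero mon k b -> homology_nonzero (colon mon v) k (b - U_(v)).
Proof.
move=> Hmon bv min [f [fk fc fb]]; set b' := (b - U_(v))%MM in min *.
have [w [wb wk wE]] : exists w, [/\ forall S, w S != 0 -> (set_mnm S <= b')%MM,
    forall S, w S != 0 -> #|S| = k &
    forall S, cell mon b' S -> contract v f S = strand_diff b' w S].
  have fk' := contract_card (v := v) fk.
  (* For [k = 0] the chain [f] lives on the empty set and has no [e_v]-part, so [w = 0] serves. *)
  case: k {fk fb} fk' min => [|k] fk' min.
    exists 0; split=> S; try by rewrite ffunE eqxx.
    rewrite linear0 [RHS]ffunE => _.
    by have [//|/fk'] := eqVneq (contract v f S) 0.
  have fk'' S : contract v f S != 0 -> #|S| = k by move/fk' => [].
  apply: (strand_boundaryP fk''); apply: NNPP => nb; apply: min => //.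
  by exists (contract v f); split => //; apply: strand_cycle_contract.
have dw : strand_diff b w = strand_diff b' w by apply: strand_diff_subU.
(* The values of [f + strand_diff b (wedge v w)] on cells, in a form that shows the support to lie
   below [b']. *)
pose y : chain := [ffun S : {set 'I_n} =>
  if cell mon b S then if v \in S then w S else f S + w S else 0].
have yE S : cell mon b S -> y S = f S + strand_diff b (wedge v w) S.
  move=> cS; rewrite ffunE cS strand_diff_wedge // dw 3!ffunE.
  case: ifP => vS; last by rewrite oppr0 addr0.
  rewrite -wE ?cell_subU ?setD1K // ?inE ?eqxx //.
  have := congr1 (fun h : chain => h S) (wedge_contract v f).
  rewrite /= ffunE [X in X + _]ffunE [X in _ + X]ffunE vS addr0 => ->.
  by rewrite addrCA subrr addr0.
have yb S : y S != 0 -> (set_mnm S <= b')%MM.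
  rewrite ffunE; case: ifP => cS; last by rewrite eqxx.
  case: ifP => vS; first exact: wb.
  by move=> _; rewrite le_set_mnm_sub ?vS //; case/andP: cS.
(* Multiplication by [x_v] embeds the colon quotient into the original one. *)
have cell_colon S : (set_mnm S <= b')%MM -> cell (colon mon v) b' S = cell mon b S.
  by move=> le; rewrite /cell le (le_sub_mnm le) /colon [in RHS](sub_mnm_set bv).
exists y; split.
- move=> S; rewrite ffunE; case: ifP => _; last by rewrite eqxx.
  case: ifP => _; first exact: wk.
  have [->|/fk //] := eqVneq (f S) 0; rewrite add0r; exact: wk.
- move=> S cS; have le : (set_mnm S <= b')%MM by case/andP: cS.
  rewrite cell_colon // in cS.
  rewrite -strand_diff_subU // (eq_strand_diff (g := f + strand_diff b (wedge v w)) Hmon cS).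
    rewrite linearD ffunE fc // add0r /=.
    by rewrite /strand_diff koszul_koszul ffunE.
  by move=> T cT; rewrite yE // ffunE.
- case/(strand_boundaryP (k := k)) => [S|t [tb tk tE]].
    rewrite ffunE; case: ifP => _; last by rewrite eqxx.
    case: ifP => _; first exact: wk.
    have [->|/fk //] := eqVneq (f S) 0; rewrite add0r; exact: wk.
  apply: fb; exists (t - wedge v w) => S cS.
  rewrite linearB !ffunE; apply/eqP; rewrite eq_sym subr_eq -yE //; apply/eqP.
  rewrite /= (strand_diff_subU tb).
  have [le|nle] := boolP (set_mnm S <= b')%MM; first by rewrite tE // cell_colon.
  have -> : y S = 0 by have [//|/yb le] := eqVneq (y S) 0; rewrite le in nle.
  rewrite strand_diffE big1 // => s sS.
  have [->|/tb] := eqVneq (t (s |: S)) 0; first by rewrite scaler0.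
  by rewrite le_set_mnmU // (negbTE nle) andbF.
Qed.

(* If multiplication by [x_v] kills nothing in the relevant degrees, the strand is
   a cone with apex [v]. *)
Lemma homology_cone mon k b v : (0 < b v)%N ->
    (forall S, cell mon (b - U_(v)) S -> ~~ mon (b - set_mnm S)%MM) ->
  ~ homology_nonzero mon k b.
Proof.
move=> bv H [f [fk fc fb]]; apply: fb; exists (wedge v f) => S cS.
rewrite strand_diff_wedge // 3!ffunE.
case: ifP => vS; last by rewrite subr0.
have vS' : v \notin S :\ v by rewrite !inE eqxx.
rewrite fc ?scaler0 ?subr0 //.
have cS' : cell mon (b - U_(v)) (S :\ v) by rewrite cell_subU // setD1K.
by rewrite /cell H // andbT; case/andP: cS' => /le_sub_mnm.
Qed.

(** A cell of [c] must contain [u] and force [c u = 1], as otherwise [x_u] divides the coefficient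
    monomial. Hence every basis element has the factor [e_u], and [contract u] removes it without
    loss. *)
Lemma homology_strip mon k c u : monomial_ideal mon -> mon U_(u)%MM -> (0 < c u)%N ->
    homology_nonzero mon k c ->
  (0 < k)%N /\ homology_nonzero mon k.-1 (c - U_(u)).
Proof.
move=> Hmon mu cu Hc.
have cell_u S : cell mon c S -> (u \in S) && (c u == 1%N).
  case/andP=> /mnm_lepP le; apply: contraR => H; apply: Hmon mu; apply/mnm_lepP=> i.
  rewrite !mnmE; case: eqP => // <-; move: H; case: (u \in S) => //=; lia.
have [f0 [S0 [cS0 S0k f0S0 _ _]]] := homology_cell Hc.
have /andP[uS0 /eqP cu1] := cell_u _ cS0.
have k0 : (0 < k)%N by rewrite -S0k card_gt0; apply/set0Pn; exists u.
split=> //; case: Hc => f [fk fc fb]; exists (contract u f).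
have fk' S : contract u f S != 0 -> #|S| = k.-1 by move/(contract_card fk) => <-.
split=> //; first exact: strand_cycle_contract.
case/(strand_boundaryP fk') => t [tb tk tE]; apply: fb.
exists (- wedge u t) => S cS; have /andP[uS _] := cell_u _ cS.
have uS' : u \notin S :\ u by rewrite !inE eqxx.
rewrite linearN /= strand_diff_wedge // (strand_diff_subU tb) 4!ffunE uS.
have -> : t S = 0.
  have [//|/tb /mnm_lepP/(_ u)] := eqVneq (t S) 0.
  by rewrite !mnmE eqxx uS cu1.
rewrite add0r opprK -tE; last by rewrite cell_subU // setD1K.
rewrite ffunE (negbTE uS') setD1K // scalerA ksignD1 -signr_addb addbb expr0 scale1r //.
Qed.

(** Each use of [homology_strip] lowers [mdeg c] and [k] together, so their difference is kept; the
    equation states this without subtraction. *)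
Lemma homology_strip_all mon k c : monomial_ideal mon -> homology_nonzero mon k c ->
  exists k' c', [/\ homology_nonzero mon k' c', forall u, mon U_(u)%MM -> c' u = 0%N,
    (mdeg c' + k = mdeg c + k')%N, (mdeg c' <= mdeg c)%N &
    (exists2 u, mon U_(u)%MM & (0 < c u)%N) -> (mdeg c' < mdeg c)%N].
Proof.
move=> Hmon; have [d] := ubnP (mdeg c); elim: d k c => // d IH k c lt Hc.
have [/existsP[u /andP[mu cu]]|] := boolP [exists u, mon U_(u)%MM && (0 < c u)%N].
  have dc := mdeg_subU cu.
  have [k0 /IH[|k' [c' [H' z' e' l' _]]]] := homology_strip Hmon mu cu Hc; first by lia.
  by exists k', c'; split => //; lia.
rewrite negb_exists => /forallP N; exists k, c; split=> // [u mu|[u mu cu]].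
  by have := N u; rewrite mu -eqn0Ngt => /eqP.
by have := N u; rewrite mu cu.
Qed.

Lemma eq_homology mon1 mon2 k b : (forall S, cell mon1 b S = cell mon2 b S) ->
  homology_nonzero mon1 k b -> homology_nonzero mon2 k b.
Proof.
move=> E [f [fk fc fb]]; exists f; split=> // [S|[g gE]].
  by rewrite -E; apply: fc.
by apply: fb; exists g => S; rewrite E; apply: gE.
Qed.

(** * Descent between strands when the ideal is generated by quadrics *)

Section Quadratic.

Variable mon : pred multideg.
Hypothesis Hmon : monomial_ideal mon.
Hypothesis mon_quad : forall m v, mon (m + U_(v))%MM ->
  mon m \/ exists2 u, (0 < m u)%N & mon (U_(u) + U_(v))%MM.

Lemma homology_descend k b r : homology_nonzero mon k b -> mdeg b = (k + r.+1)%N ->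
  exists k' b', [/\ homology_nonzero mon k' b', mdeg b' = (k' + r)%N & (k' < k)%N].
Proof.
have [d] := ubnP (mdeg b); elim: d k b => // d IH k b lt Hb db.
have [v bv] : exists v, (0 < b v)%N.
  have : mdeg b != 0%N by lia.
  rewrite mdegE sum_nat_eq0 negb_forall => /existsP[v]; rewrite /= -lt0n; by exists v.
have dc := mdeg_subU bv.
(* A class in degree [b - U_(v)] with index [k.-1] has the same [r] and smaller degree, so induction
   replaces the choice of a minimal [b]. *)
have [[k0 Hc]|min] := classic ((0 < k)%N /\ homology_nonzero mon k.-1 (b - U_(v))).
  have [||k' [b' [? ? ?]]] := IH _ _ _ Hc; [lia|lia|].
  by exists k', b'; split => //; lia.
have Hcolon : monomial_ideal (colon mon v).
  move=> m1 m2 /mnm_lepP le; apply: Hmon; apply/mnm_lepP=> i.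
  by rewrite !mnmDE leq_add2r.
have Hc : homology_nonzero (colon mon v) k (b - U_(v)).
  by apply: homology_colon => // k0 H; apply: min.
have [k' [c' [H' z' e' _ l']]] := homology_strip_all Hcolon Hc.
(* If no variable could be stripped, [mon_quad] would make multiplication by [x_v] injective on the
   cells, and the strand would be a cone. *)
have : (mdeg c' < mdeg (b - U_(v)))%N.
  apply: l'; apply: NNPP => N.
  apply: (homology_cone bv _ Hb) => S /andP[le nm]; rewrite (sub_mnm_set bv le).
  apply: contra nm => /mon_quad[//|[u mu muv]]; case: N; exists u => //.
  by apply: leq_trans mu _; rewrite mnmBE leq_subr.
move=> lt'; exists k', c'; split; [|lia|lia].
(* No variable of the colon ideal divides [x^c'] any more, so below [c'] the colon ideal and [mon]
   have the same monomials. *)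
apply: eq_homology H' => S; rewrite /cell; have [le|//] := boolP (set_mnm S <= c')%MM.
congr (~~ _); apply/idP/idP; last by apply: Hmon; rewrite lem_addr.
case/mon_quad=> // -[u mu muv]; have := z' u muv.
by move: mu; rewrite mnmBE; lia.
Qed.

(** Descending [r] times lowers [k] at least [r] times. This is the bound given by the Taylor
    resolution of a quadratic monomial ideal. *)
Lemma homology_strand_le k b r :
  homology_nonzero mon k b -> mdeg b = (k + r)%N -> (r <= k)%N.
Proof.
elim: r k b => // r IH k b Hb /(homology_descend Hb)[k' [b' [H' d' lt]]].
by apply: leq_ltn_trans lt; apply: IH H' d'.
Qed.

(** If the degree were [k], the monomial of [b] would be the product over some [S] with [f S]
    nonzero. At [S :\ v] the differential is then [f S] up to sign, and its monomial [x_v] is not in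
    the ideal. *)
Lemma homology_lt_mdeg k b : (forall v, ~~ mon U_(v)%MM) -> (0 < k)%N ->
  homology_nonzero mon k b -> (k < mdeg b)%N.
Proof.
move=> lin k0 /homology_cell[f [S [/andP[le nm] Sk fS fc _]]].
have eb : b = (b - set_mnm S + set_mnm S)%MM by rewrite submK.
have : mdeg b = (mdeg (b - set_mnm S) + k)%N by rewrite {1}eb mdegD mdeg_set_mnm Sk.
case: (posnP (mdeg (b - set_mnm S))) => [|? ?]; last by lia.
move/eqP; rewrite mdeg_eq0 => /eqP b0 _; rewrite {}b0 add0m in eb.
have [v vS] : exists v, v \in S by apply/set0Pn; rewrite -card_gt0 Sk.
have vS' : v \notin S :\ v by rewrite !inE eqxx.
have cS : cell mon b (S :\ v).
  apply/andP; split; first by apply/mnm_lepP=> i; rewrite eb !mnmE !inE; case: (_ == _).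
  have -> : (b - set_mnm (S :\ v) = U_(v))%MM; last by [].
  apply/mnmP=> i; rewrite eb !mnmE !inE [i == v]eq_sym.
  by case: eqP => [<-|_] /=; rewrite ?vS // subnn.
have := fc _ cS; rewrite strand_diffE (bigD1 v) //= big1 => [|s /andP[sS sv]].
  rewrite addr0 setD1K // => /eqP; rewrite scaler_eq0 (negbTE fS) orbF.
  by rewrite mulf_eq0 signr_eq0 orbF eb mnmE vS oner_eq0.
have sS' : s \notin S by move: sS; rewrite !inE sv.
by rewrite eb mnmE (negbTE sS') mul0r scale0r.
Qed.

End Quadratic.

End MultigradedHomology.

(** * Coefficients of polynomials, and modules described by coefficients *)

Section MpolyCoefficients.

Variables (K : fieldType) (n : nat).
Local Notation R := {mpoly K[n]}.
Implicit Types (v : 'I_n) (f : R) (m : 'X_{1..n}).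

Definition mpoly_trunc d (E : 'X_{1..n} -> K) : R :=
  \sum_(m : 'X_{1..n < d}) E m *: 'X_[m].

Lemma mcoeff_trunc d E m :
  (mpoly_trunc d E)@_m = if (mdeg m < d)%N then E m else 0.
Proof.
case: ifP => [lt|ge]; first exact: mcoeff_mpoly.
rewrite /mpoly_trunc raddf_sum big1 //= => k _; rewrite mcoeffZ mcoeffX.
by case: eqP => [e|]; rewrite ?mulr0 //; rewrite -e bmdeg in ge.
Qed.

Lemma mcoeff_msize f m : (msize f <= mdeg m)%N -> f@_m = 0.
Proof. by move=> le; apply/memN_msupp_eq0/msize_mdeg_ge. Qed.

Lemma mcoeffXM k f m :
  ('X_[k] * f)@_m = if (k <= m)%MM then f@_(m - k) else 0.
Proof.
rewrite mulrC; case: ifP => [le|nle]; first by rewrite -{1}(submK le) addmC mcoeffMX.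
apply: memN_msupp_eq0; rewrite (perm_mem (msuppMX _ _)).
by apply/negP=> /mapP[m' _ e]; rewrite e lem_addr in nle.
Qed.

Lemma lem_mnm1 v m : (U_(v) <= m)%MM = (0 < m v)%N.
Proof.
apply/mnm_lepP/idP => [/(_ v)|mv i]; rewrite mnm1E ?eqxx //.
by case: eqP => // <-.
Qed.

End MpolyCoefficients.

(* A module whose elements are determined by finitely many families of coefficients,
   on which the elements [X s] act by shifting exponents: finite free modules over a
   polynomial ring, with the polynomial ring itself kept abstract. *)
Record coef_structure (K : fieldType) (n : nat) (R : comNzRingType) (X : 'I_n -> R)
    (V : lmodType R) := CoefStructure {
  cs_index : finType;
  cs_coef : cs_index -> 'X_{1..n} -> V -> K;
  cs_coefB : forall i m, zmod_morphism (cs_coef i m);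
  cs_coefX : forall i m s x, cs_coef i m (X s *: x) =
    if (0 < m s)%N then cs_coef i (m - U_(s))%MM x else 0;
  cs_coef_inj : forall x y, (forall i m, cs_coef i m x = cs_coef i m y) -> x = y;
  cs_build : nat -> (cs_index -> 'X_{1..n} -> K) -> V;
  cs_coef_build : forall d E i m,
    cs_coef i m (cs_build d E) = if (mdeg m < d)%N then E i m else 0;
  cs_bound : V -> nat;
  cs_coef_bound : forall i m x, (cs_bound x <= mdeg m)%N -> cs_coef i m x = 0
}.

Arguments cs_coef {K n R X V} c.
Arguments cs_coef_inj {K n R X V} c.
Arguments cs_build {K n R X V} c.
Arguments cs_bound {K n R X V} c.

(** * Exactness of the Koszul complex on the variables *)

Section KoszulCoefficients.

Variables (K : fieldType) (n : nat) (R : comNzRingType) (X : 'I_n -> R).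
Variables (V : lmodType R) (cs : coef_structure K X V).
Local Notation chain := {ffun {set 'I_n} -> V}.
Local Notation idx := (cs_index cs).
Local Notation coef := (cs_coef cs).
Local Notation d := (koszul X).
Implicit Types (u v s : 'I_n) (S : {set 'I_n}) (z w : chain) (m : 'X_{1..n}) (x y : V) (i : idx).

HB.instance Definition _ i m :=
  GRing.isZmodMorphism.Build V K (coef i m) (cs_coefB i m).

Lemma coef_sign i m (b : bool) x : coef i m ((-1) ^+ b *: x) = (-1) ^+ b * coef i m x.
Proof. by case: b; rewrite ?expr0 ?expr1 ?scale1r ?mul1r ?scaleN1r ?mulN1r ?raddfN. Qed.

Lemma coef_koszul i m z S : coef i m (d z S) =
  \sum_(s | s \notin S) (-1) ^+ ksign s S *
    (if (0 < m s)%N then coef i (m - U_(s))%MM (z (s |: S)) else 0).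
Proof.
rewrite koszulE raddf_sum; apply: eq_bigr => s _ /=.
by rewrite mulrC -scalerA coef_sign cs_coefX.
Qed.

(** Division by [X v], dropping the terms not divisible by it. The bound of [x] suffices because
    exponents only go down. *)
Definition quo v x : V := cs_build cs (cs_bound cs x) (fun i m => coef i (m + U_(v))%MM x).

Lemma coef_quo v x i m : coef i m (quo v x) = coef i (m + U_(v))%MM x.
Proof.
rewrite cs_coef_build; case: ltnP => // le.
by rewrite cs_coef_bound // mdegD (leq_trans le) // leq_addr.
Qed.

Lemma quo_is_zmod_morphism v : zmod_morphism (quo v).
Proof.
by move=> x y; apply: (cs_coef_inj cs) => i m; rewrite raddfB /= !coef_quo raddfB.
Qed.

HB.instance Definition _ v :=
  GRing.isZmodMorphism.Build V V (quo v) (quo_is_zmod_morphism v).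

Lemma quo_sign v (b : bool) x : quo v ((-1) ^+ b *: x) = (-1) ^+ b *: quo v x.
Proof. by case: b; rewrite ?expr0 ?expr1 ?scale1r ?scaleN1r ?raddfN. Qed.

Lemma quoX v s x : quo v (X s *: x) = if s == v then x else X s *: quo v x.
Proof.
apply: (cs_coef_inj cs) => i m.
rewrite coef_quo cs_coefX mnmDE mnm1E [s == v]eq_sym.
case: eqP => [<-|vs]; first by rewrite addn1 addmK.
rewrite addn0 cs_coefX coef_quo; case: ltnP => // ms.
congr (coef i _ _); apply/mnmP=> t; rewrite !mnmE.
by case: (s =P t) => [<-|]; case: (v =P _) => //; lia.
Qed.

Definition chain_quo v z : chain := [ffun S : {set 'I_n} => quo v (z S)].

(** Division by [X v] commutes with every [X s] except [X v] itself; the correction is the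
    contraction of the remainder. *)
Lemma chain_quo_koszul v z : chain_quo v (d z) =
  d (chain_quo v z) + contract v (z - X v *: chain_quo v z).
Proof.
have term s S : quo v ((X s *: contract s z) S) =
    if s == v then contract v z S else (X s *: contract s (chain_quo v z)) S.
  rewrite ffunE quoX; case: eqP => [-> //|_]; rewrite !ffunE; congr (_ *: _).
  by case: ifP => _; rewrite ?raddf0 // quo_sign.
apply/ffunP=> S.
have -> : chain_quo v (d z) S =
    contract v z S + \sum_(s | s != v) (X s *: contract s (chain_quo v z)) S.
  rewrite ffunE sum_ffunE raddf_sum (bigD1 v) //= term eqxx; congr (_ + _).
  by apply: eq_bigr => s sv; rewrite term (negbTE sv).
rewrite [RHS]ffunE.
have -> : d (chain_quo v z) S = (X v *: contract v (chain_quo v z)) S +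
    \sum_(s | s != v) (X s *: contract s (chain_quo v z)) S.
  by rewrite /koszul sum_ffunE (bigD1 v).
have -> : contract v (z - X v *: chain_quo v z) S =
    contract v z S - (X v *: contract v (chain_quo v z)) S.
  by rewrite linearB linearZ /= [LHS]ffunE [Y in _ + Y]ffunE.
by rewrite addrC [RHS]addrC addrA addrNK addrC.
Qed.

(* Setting [x_v] to [0] and discarding [e_v] is homotopic to the identity. *)
Lemma koszul_homotopy v z :
  d (wedge v (chain_quo v z)) + wedge v (chain_quo v (d z)) =
  z - contract v (wedge v (z - X v *: chain_quo v z)).
Proof.
rewrite koszul_wedge chain_quo_koszul linearD /= addrA addrNK.
set r := z - X v *: chain_quo v z; have -> : X v *: chain_quo v z = z - r by rewrite subKr.
rewrite -[Y in z - Y + _](wedge_contract v r) opprD addrA.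
by rewrite addrAC addrNK.
Qed.

Lemma coef_drop v z S i m :
  coef i m (contract v (wedge v (z - X v *: chain_quo v z)) S) =
  if (v \in S) || (0 < m v)%N then 0 else coef i m (z S).
Proof.
rewrite ffunE; case: ifP => vS /=; first by rewrite raddf0.
rewrite ffunE setU11 scalerA ksignU1 -signr_addb addbb expr0 scale1r.
rewrite setU1K ?vS // 4!ffunE raddfB /= cs_coefX coef_quo.
by case: ifP => mv; rewrite ?submK ?lem_mnm1 // ?subrr ?subr0.
Qed.

(** Applying the homotopy for one variable of [l] after another changes the cycle only by
    boundaries. *)
Lemma koszul_reduce (l : seq 'I_n) z : d z = 0 ->
  exists w z', [/\ z = z' + d w, d z' = 0 &
    forall S i m, coef i m (z' S) =
      if has (fun v => (v \in S) || (0 < m v)%N) l then 0 else coef i m (z S)].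
Proof.
elim: l => [|v l IH] dz; first by exists 0, z; rewrite linear0 addr0.
have [w [z' [ez dz' cz']]] := IH dz.
exists (w + wedge v (chain_quo v z')), (contract v (wedge v (z' - X v *: chain_quo v z'))).
have := koszul_homotopy v z'; rewrite dz'.
have -> : chain_quo v 0 = 0 by apply/ffunP=> S; rewrite !ffunE raddf0.
rewrite linear0 addr0 => E.
have {}E : z' = contract v (wedge v (z' - X v *: chain_quo v z')) +
    d (wedge v (chain_quo v z')) by rewrite E addrC addrNK.
split.
- by rewrite [d (w + _)]linearD /= addrCA -E addrC.
- have := congr1 d E; rewrite linearD /= koszul_koszul addr0 => <-.
  exact: dz'.
- by move=> S i m; rewrite coef_drop cz' /=; case: ifP.
Qed.

(** After reduction along all variables, only constant coefficients at [set0] could survive. *)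
Lemma koszul_exact z : d z = 0 -> (forall i, coef i 0%MM (z set0) = 0) ->
  exists w, z = d w.
Proof.
move=> dz z0; have [w [z' [ez _ cz']]] := koszul_reduce (enum 'I_n) dz.
exists w; rewrite {1}ez; suff -> : z' = 0 by rewrite add0r.
apply/ffunP=> S; rewrite ffunE; apply: (cs_coef_inj cs) => i m.
rewrite raddf0 cz'; case: ifPn => // /hasPn H.
have -> : S = set0.
  by apply/setP=> v; rewrite inE; have := H v; rewrite mem_enum => /(_ isT); case: (v \in S).
have -> : m = 0%MM; last exact: z0.
apply/mnmP=> v; rewrite mnm0E; apply/eqP; have := H v; rewrite mem_enum => /(_ isT).
by rewrite negb_or -eqn0Ngt => /andP[].
Qed.

Lemma koszul_coef0 w i : coef i 0%MM (d w set0) = 0.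
Proof. by rewrite coef_koszul big1 // => s _; rewrite mnm0E mulr0. Qed.

(* Degree [j] part of [x], when the [i]-th generator has degree [e i]. *)
Definition degree_part (j : nat) (e : idx -> nat) x : V :=
  cs_build cs (cs_bound cs x)
    (fun i m => if (mdeg m + e i == j)%N then coef i m x else 0).

Lemma coef_degree_part j e x i m :
  coef i m (degree_part j e x) = if (mdeg m + e i == j)%N then coef i m x else 0.
Proof.
rewrite cs_coef_build; case: ltnP => // le.
by rewrite cs_coef_bound // if_same.
Qed.

(** A term [X^m e_S] on generator [i] has total degree [mdeg m + #|S| + sh i], which the
    differential preserves. *)
Definition bidegree_part (sh : idx -> nat) (k j : nat) z : chain :=
  [ffun S : {set 'I_n} =>
    if #|S| == k then degree_part j (fun i => k + sh i)%N (z S) else 0].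

Lemma coef_bidegree_part sh k j z S i m : coef i m (bidegree_part sh k j z S) =
  if (#|S| == k) && (mdeg m + (k + sh i) == j)%N then coef i m (z S) else 0.
Proof.
by rewrite ffunE; case: ifP => _ /=; rewrite ?raddf0 // coef_degree_part.
Qed.

Lemma bidegree_part_koszul sh k j z :
  d (bidegree_part sh k.+1 j z) = bidegree_part sh k j (d z).
Proof.
apply/ffunP=> S; apply: (cs_coef_inj cs) => i m.
rewrite coef_bidegree_part !coef_koszul.
have term s : s \notin S -> (0 < m s)%N ->
    coef i (m - U_(s))%MM (bidegree_part sh k.+1 j z (s |: S)) =
    if (#|S| == k) && (mdeg m + (k + sh i) == j)%N
    then coef i (m - U_(s))%MM (z (s |: S)) else 0.
  move=> sS ms; rewrite coef_bidegree_part cardsU1 sS eqSS (mdeg_subU ms).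
  by rewrite [(k.+1 + _)%N]addSn addnS addSn.
case: ifP => Hjk; [apply: eq_bigr | apply: big1] => s sS;
  by case: ltnP => ms; rewrite ?mulr0 // term // Hjk ?mulr0.
Qed.

Lemma bidegree_part_idem sh k j z :
  bidegree_part sh k j (bidegree_part sh k j z) = bidegree_part sh k j z.
Proof.
apply/ffunP=> S; apply: (cs_coef_inj cs) => i m.
by rewrite !coef_bidegree_part; case: ifP => // ->.
Qed.

End KoszulCoefficients.

(** * Dimension shifting along a minimal resolution *)

Section DimensionShift.

Variables (K : fieldType) (n : nat) (R : comNzRingType) (X : 'I_n -> R).
Variables (V : nat -> lmodType R) (cs : forall i, coef_structure K X (V i)).
Variables (D : forall i, {linear V i.+1 -> V i}) (sh : forall i, cs_index (cs i) -> nat).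
Arguments sh : clear implicits.
Hypothesis D_exact : forall i x, D i x = 0 <-> exists y, x = D i.+1 y.
Hypothesis D_degree : forall i k j x, degree_part j (fun a => k + sh i a)%N (D i x) =
  D i (degree_part j (fun a => k + sh i.+1 a)%N x).
Hypothesis D_minimal : forall i x a, cs_coef (cs i) a 0%MM (D i x) = 0.

Local Notation chain i := {ffun {set 'I_n} -> V i}.
Local Notation d := (koszul X).

Definition push i (z : chain i.+1) : chain i := [ffun S : {set 'I_n} => D i (z S)].

Lemma push_is_linear i : linear (@push i).
Proof. by move=> c z w; apply/ffunP=> S; rewrite !ffunE linearP. Qed.

HB.instance Definition _ i := GRing.isLinear.Build R (chain i.+1) (chain i) _ (@push i)
  (@push_is_linear i).

Lemma koszul_push i (z : chain i.+1) : d (push z) = push (d z).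
Proof.
apply/ffunP=> S; rewrite koszulE ffunE koszulE linear_sum.
by apply: eq_bigr => s _; rewrite ffunE linearZ.
Qed.

Lemma push_push i (z : chain i.+2) : push (push z) = 0.
Proof. by apply/ffunP=> S; rewrite !ffunE; apply/D_exact; exists (z S). Qed.

Lemma push_exact i (z : chain i.+1) : push z = 0 -> exists w, z = push w.
Proof.
move=> z0; have /fin_all_exists[w wP] (S : {set 'I_n}) : exists w, z S = D i.+1 w.
  by apply/D_exact; move/ffunP/(_ S): z0; rewrite !ffunE.
by exists [ffun S => w S]; apply/ffunP=> S; rewrite !ffunE.
Qed.

Lemma bidegree_part_push i k j (z : chain i.+1) :
  bidegree_part (sh i) k j (push z) = push (bidegree_part (sh i.+1) k j z).
Proof.
apply/ffunP=> S; rewrite !ffunE; case: ifP => _; last by rewrite linear0.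
exact: D_degree.
Qed.

(* The [j]-graded part of the [k]-th Koszul homology of the cokernel of [D i] is
   nonzero. *)
Definition syzygy_homology i k j := exists z : chain i,
  [/\ bidegree_part (sh i) k j z = z, exists w, d z = push w &
      ~ exists u t, z = d u + push t].

Lemma push_coef0 i (z : chain i.+1) S a : cs_coef (cs i) a 0%MM (push z S) = 0.
Proof. by rewrite ffunE D_minimal. Qed.

(** The class of [w] is the image of [z] under the connecting map. If it vanishes, [z] differs from
    an image by a Koszul cycle, which is a boundary by exactness. *)
Lemma syzygy_homology_down i k j : syzygy_homology i k.+1 j -> syzygy_homology i.+1 k j.
Proof.
case=> z [zh [w dz] nz]; pose w' := bidegree_part (sh i.+1) k j w.
have {}dz : d z = push w'.
  by rewrite -bidegree_part_push -dz -bidegree_part_koszul zh.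
exists w'; split; first exact: bidegree_part_idem.
  by apply: push_exact; rewrite -koszul_push -dz koszul_koszul.
case=> u [t wE]; apply: nz.
have [||x zE] := koszul_exact (cs := cs i) (z := z - push u).
- by rewrite linearB /= dz wE linearD /= push_push addr0 koszul_push subrr.
(* Here [z] lives on nonempty sets, and images have no constant coefficients by minimality. *)
- move=> a; rewrite ffunE [Y in _ + Y]ffunE raddfB /= push_coef0 subr0.
  by rewrite -zh coef_bidegree_part cards0.
- by exists x, u; rewrite -zE subrK.
Qed.

(** The connecting map is inverted by lifting [push w], a cycle without constant coefficients,
    through the Koszul differential. *)
Lemma syzygy_homology_up i k j : syzygy_homology i.+1 k j -> syzygy_homology i k.+1 j.
Proof.
case=> w [wh [t dw] nw].
have [||z zE] := koszul_exact (cs := cs i) (z := push w).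
- by rewrite koszul_push dw push_push.
- by move=> a; apply: push_coef0.
exists (bidegree_part (sh i) k.+1 j z); split.
- exact: bidegree_part_idem.
- by exists w; rewrite bidegree_part_koszul -zE bidegree_part_push wh.
case=> u [x zx]; apply: nw.
have : push (w - d x) = 0.
  rewrite linearB /= -koszul_push -[Y in Y - _](_ : push (bidegree_part (sh i.+1) k j w) = _).
    rewrite -bidegree_part_push zE.
    by rewrite -bidegree_part_koszul zx linearD /= koszul_koszul add0r subrr.
  by rewrite wh.
case/push_exact=> y yE; exists x, y.
by rewrite -yE addrC subrK.
Qed.

Lemma syzygy_homology_shift i k j : syzygy_homology i k j <-> syzygy_homology (k + i) 0 j.
Proof.
elim: k i => [|k IH] i //; rewrite addSnnS -IH.
by split; [apply: syzygy_homology_down | apply: syzygy_homology_up].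
Qed.

(** In Koszul degree zero one divides by the variables and by the image of [D i]. Minimality puts
    the latter inside the former, so the generators remain as a basis. *)
Lemma syzygy_homology0 i j :
  syzygy_homology i 0 j <-> exists a, sh i a = j.
Proof.
split=> [[z [zh _ nz]]|[a aj]].
  apply: NNPP => N; apply: nz.
  have [||w ->] := koszul_exact (cs := cs i) (z := z).
  - apply/ffunP=> S; rewrite koszulE ffunE big1 // => s sS.
    by rewrite -zh ffunE cardsU1 sS scaler0.
  - move=> a; rewrite -zh coef_bidegree_part cards0 mdeg0 !add0n /=.
    by case: eqP => // aj; case: N; exists a.
  - by exists w, 0; rewrite linear0 addr0.
pose x := cs_build (cs i) 1 (fun b m => ((b == a) && (m == 0%MM))%:R).
have xE b m : cs_coef (cs i) b m x = ((b == a) && (m == 0%MM))%:R.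
  rewrite cs_coef_build; case: ltnP => // m0; case: (m =P 0%MM) m0 => [->|].
    by rewrite mdeg0.
  by rewrite andbF.
pose z : chain i := [ffun S : {set 'I_n} => if S == set0 then x else 0].
have zE (S : {set 'I_n}) : #|S| != 0%N -> z S = 0 by rewrite cards_eq0 ffunE => /negbTE ->.
exists z; split.
- apply/ffunP=> S; apply: (cs_coef_inj (cs i)) => b m; rewrite coef_bidegree_part.
  have [/eqP|/zE ->] := eqVneq #|S| 0%N; last by rewrite raddf0.
  rewrite cards_eq0 => /eqP -> /=; rewrite ffunE eqxx xE add0n.
  case: eqP => // nj; case: eqP => //= eb; case: eqP => // m0.
  by case: nj; rewrite m0 mdeg0 eb aj.
- exists 0; rewrite linear0; apply/ffunP=> S; rewrite koszulE ffunE big1 // => s sS.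
  by rewrite zE ?scaler0 // cardsU1 sS.
- case=> u [t zt]; have := congr1 (fun h : chain i => cs_coef (cs i) a 0%MM (h set0)) zt.
  rewrite /= [(d u + _) _]ffunE raddfD /= koszul_coef0 push_coef0 ffunE eqxx xE !eqxx.
  by rewrite addr0 => /eqP; rewrite oner_eq0.
Qed.

(** * Splitting the homology of a monomial quotient into strands *)

Section MonomialCokernel.

Variables (mon : pred 'X_{1..n}) (o : cs_index (cs 0)).
Hypothesis only_o : forall a, a = o.
Hypothesis sh_o : sh 0 o = 0%N.
Hypothesis D_image : forall x, (exists y, x = D 0 y) <->
  forall m, cs_coef (cs 0) o m x != 0 -> mon m.
Local Notation coef := (cs_coef (cs 0) o).
Implicit Types (S T : {set 'I_n}) (b m : 'X_{1..n}).

Definition strand b (z : chain 0) : {ffun {set 'I_n} -> K^o} :=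
  [ffun S : {set 'I_n} => if (set_mnm S <= b)%MM then coef (b - set_mnm S)%MM (z S) else 0].

Lemma coef_koszul_strand (z : chain 0) S m :
  coef m (d z S) = strand_diff (m + set_mnm S) (strand (m + set_mnm S) z) S.
Proof.
rewrite coef_koszul strand_diffE; apply: eq_bigr => s sS.
have -> : (m + set_mnm S)%MM s = m s by rewrite mnmDE mnmE (negbTE sS) addn0.
rewrite ffunE le_set_mnmU // mnmDE mnmE (negbTE sS) addn0 lem_addl andbT.
case: ifP => ms; last by rewrite mulr0 scaler0.
rewrite mul1r sub_set_mnmU //; congr (_ * coef _ _).
apply/mnmP=> i; rewrite !mnmE; case: eqP => [<-|_]; first by rewrite (negbTE sS); lia.
by lia.
Qed.

Lemma push_image (z : chain 0) :
  (exists w, z = push w) <-> forall S m, coef m (z S) != 0 -> mon m.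
Proof.
split=> [[w ->] S|H].
  by rewrite ffunE; apply/D_image; exists (w S).
have /fin_all_exists[w wP] (S : {set 'I_n}) : exists w, z S = D 0 w by apply/D_image/H.
by exists [ffun S => w S]; apply/ffunP=> S; rewrite !ffunE.
Qed.

Lemma eq_strand_diff_le b (f g : {ffun {set 'I_n} -> K^o}) S : (set_mnm S <= b)%MM ->
  (forall T, (set_mnm T <= b)%MM -> f T = g T) -> strand_diff b f S = strand_diff b g S.
Proof.
move=> le fg; apply: (@eq_strand_diff K n pred0) => // [|T]; first by rewrite /cell le.
by rewrite /cell andbT; apply: fg.
Qed.

Lemma strand_homology_syzygy k b :
  homology_nonzero K mon k b -> syzygy_homology 0 k (mdeg b).
Proof.
case=> f [fk fc fb].
(* The multihomogeneous chain of multidegree [b] with coefficients [f]; no monomial in it exceeds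
   degree [mdeg b]. *)
pose z : chain 0 := [ffun S : {set 'I_n} => if (set_mnm S <= b)%MM then
  cs_build (cs 0) (mdeg b).+1 (fun _ m => if m == (b - set_mnm S)%MM then f S else 0) else 0].
have zE S m : coef m (z S) = if (m + set_mnm S == b)%MM then f S else 0.
  rewrite ffunE; case: ifP => le; last first.
    by rewrite raddf0; case: eqP => // e; rewrite -e lem_addl in le.
  rewrite cs_coef_build; have -> : (m == (b - set_mnm S)%MM) = (m + set_mnm S == b)%MM.
    by apply/eqP/eqP => [->|<-]; rewrite ?submK ?addmK.
  case: eqP => [<-|]; last by rewrite if_same.
  by rewrite ltnS mdegD leq_addr.
have strandE S : (set_mnm S <= b)%MM -> strand b z S = f S.
  by move=> le; rewrite ffunE le zE submK // eqxx.
have strand0 b' : b' != b -> strand b' z = 0.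
  move=> nb; apply/ffunP=> S; rewrite [LHS]ffunE [RHS]ffunE; case: ifP => // le.
  by rewrite zE submK // (negbTE nb).
exists z; split.
- apply/ffunP=> S; apply: (cs_coef_inj (cs 0)) => a m; rewrite (only_o a) coef_bidegree_part.
  case: ifP => // H; rewrite zE; case: eqP => // e.
  have [//|/fk Sk] := eqVneq (f S) 0.
  by move: H; rewrite Sk eqxx -e mdegD mdeg_set_mnm Sk sh_o addn0 eqxx.
- apply/push_image => S m; rewrite coef_koszul_strand.
  have [e|nb] := eqVneq (m + set_mnm S)%MM b; last first.
    by rewrite strand0 // linear0 ffunE eqxx.
  rewrite e; apply: contraR => nm.
  have le : (set_mnm S <= b)%MM by rewrite -e lem_addl.
  rewrite (eq_strand_diff_le le strandE) fc // /cell le -e addmK //.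
- case=> u [t zt]; apply: fb; exists (strand b u) => S /andP[le nm].
  rewrite -strandE // ffunE le zt ffunE raddfD /= [Y in _ + Y](_ : _ = 0) ?addr0.
    by rewrite coef_koszul_strand submK.
  have [//|nz] := eqVneq (coef (b - set_mnm S)%MM (push t S)) 0.
  by case/negP: nm; apply: (proj1 (push_image (push t)) _ S) => //; exists t.
Qed.

Lemma syzygy_strand_homology k j : syzygy_homology 0 k j ->
  exists2 b, mdeg b = j & homology_nonzero K mon k b.
Proof.
case=> z [zh /push_image dz nz]; apply: NNPP => N; apply: nz.
have zj S m : coef m (z S) != 0 -> #|S| = k /\ mdeg (m + set_mnm S)%MM = j.
  rewrite -zh coef_bidegree_part; case: ifP; rewrite ?eqxx // => /andP[/eqP Sk /eqP mj] _.
  by rewrite mdegD mdeg_set_mnm Sk -mj sh_o addn0.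
have bdry b : mdeg b = j -> strand_boundary mon b (strand b z).
  move=> bj; apply: NNPP => nb; apply: N; exists b => //; exists (strand b z); split=> // S.
    by rewrite ffunE; case: ifP => _; rewrite ?eqxx // => /zj[].
  case/andP=> le nm; apply/eqP; apply: contraR nm => nz0; apply: (dz S).
  by rewrite coef_koszul_strand submK.
(* Only finitely many multidegrees have degree [j], so their bounding chains can be chosen together
   and glued into one chain [u]. *)
have /fin_all_exists[G GP] (B : 'X_{1..n < j.+1}) : exists g : {ffun {set 'I_n} -> K^o},
    mdeg B = j -> forall S, cell mon B S -> strand B z S = strand_diff B g S.
  have [/bdry[g gP]|nj] := eqVneq (mdeg B) j; first by exists g.
  by exists 0 => e; rewrite e eqxx in nj.
pose G' b := if insub b is Some B then G B else 0.
have G'P b : mdeg b = j -> forall S, cell mon b S -> strand b z S = strand_diff b (G' b) S.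
  move=> bj S; rewrite /G'; case: insubP => [B _ eB|]; last by rewrite bj ltnSn.
  by move: (GP B); rewrite (eB : bmnm B = b) => /(_ bj S).
pose u : chain 0 := [ffun S : {set 'I_n} => cs_build (cs 0) j.+1 (fun _ m =>
  if mdeg (m + set_mnm S)%MM == j then G' (m + set_mnm S)%MM S else 0)].
have uE S m : coef m (u S) =
    if mdeg (m + set_mnm S)%MM == j then G' (m + set_mnm S)%MM S else 0.
  rewrite ffunE cs_coef_build; case: ltnP => // le; case: eqP => // e.
  by move: le; rewrite -e mdegD ltnNge leq_addr.
suff /push_image[t tE] : forall S m, coef m ((z - d u) S) != 0 -> mon m.
  by exists u, t; rewrite -tE addrC subrK.
move=> S m; apply: contraR => nm.
rewrite ffunE [Y in _ + Y]ffunE raddfB /= coef_koszul_strand.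
set b := (m + set_mnm S)%MM; have le : (set_mnm S <= b)%MM by rewrite lem_addl.
have strandu T : (set_mnm T <= b)%MM -> strand b u T = if mdeg b == j then G' b T else 0.
  by move=> leT; rewrite ffunE leT uE submK.
have [bj|nj] := eqVneq (mdeg b) j; last first.
  have -> : coef m (z S) = 0.
    by have [//|/zj[_ e]] := eqVneq (coef m (z S)) 0; rewrite e eqxx in nj.
  rewrite (eq_strand_diff_le (g := 0) le) => [|T leT]; first by rewrite linear0 ffunE subrr.
  by rewrite strandu // (negbTE nj) ffunE.
rewrite (eq_strand_diff_le (g := G' b) le) => [|T leT]; last by rewrite strandu // bj eqxx.
rewrite -G'P //; last by rewrite /cell le addmK.
by rewrite ffunE le addmK subrr.
Qed.

End MonomialCokernel.

End DimensionShift.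

(** * Row vectors of polynomials as modules with coefficients *)

Section RowCoefficients.

Variables (K : fieldType) (n q : nat).
Local Notation R := {mpoly K[n]}.

Definition row_coef (a : 'I_q) (m : 'X_{1..n}) (x : 'rV[R]_q) : K := (x 0 a)@_m.

Definition row_build (e : nat) (E : 'I_q -> 'X_{1..n} -> K) : 'rV[R]_q :=
  \row_a mpoly_trunc e (E a).

Definition row_bound (x : 'rV[R]_q) : nat := \max_(a < q) msize (x 0%R a).

Lemma row_coefB a m : zmod_morphism (row_coef a m).
Proof. by move=> x y; rewrite /row_coef !mxE mcoeffB. Qed.

Lemma row_coefX a m s (x : 'rV[R]_q) : row_coef a m ('X_s *: x) =
  if (0 < m s)%N then row_coef a (m - U_(s))%MM x else 0.
Proof. by rewrite /row_coef mxE mcoeffXM lem_mnm1. Qed.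

Lemma row_coef_inj (x y : 'rV[R]_q) :
  (forall a m, row_coef a m x = row_coef a m y) -> x = y.
Proof. by move=> e; apply/rowP=> a; apply/mpolyP=> m; apply: e. Qed.

Lemma row_coef_build e E a m :
  row_coef a m (row_build e E) = if (mdeg m < e)%N then E a m else 0.
Proof. by rewrite /row_coef mxE mcoeff_trunc. Qed.

Lemma row_coef_bound a m (x : 'rV[R]_q) :
  (row_bound x <= mdeg m)%N -> row_coef a m x = 0.
Proof.
move=> le; apply: mcoeff_msize; apply: leq_trans le.
exact: (leq_bigmax (F := fun a => msize (x 0 a))).
Qed.

Definition row_coefs : coef_structure K (fun s : 'I_n => 'X_s : R) 'rV[R]_q :=
  CoefStructure row_coefB row_coefX row_coef_inj row_coef_build row_coef_bound.

End RowCoefficients.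

(** * Ideals generated by monomials *)

Section MonomialGenerators.

Variables (K : fieldType) (n : nat).
Implicit Types (I : {mpoly K[n]} -> Prop) (m : 'X_{1..n}) (gens : seq 'X_{1..n}).

Definition divisible_by gens : pred 'X_{1..n} := fun m => has (fun u => (u <= m)%MM) gens.

Lemma divisible_by_ideal gens : monomial_ideal (divisible_by gens).
Proof.
move=> m1 m2 le /hasP[u uS um]; apply/hasP; exists u => //.
exact: lepm_trans um le.
Qed.

Lemma divisible_by_mdeg gens e m : (forall u, u \in gens -> mdeg u = e) ->
  (mdeg m < e)%N -> ~~ divisible_by gens m.
Proof.
move=> ge lt; apply/hasPn=> u ug; apply: contraL lt => le.
by rewrite -leqNgt -(ge u ug) -(submK le) mdegD leq_addl.
Qed.

(** A generator that divides [x^m x_v] but not [x^m] involves [x_v]; its other factor is a variable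
    [x_u] dividing [x^m]. *)
Lemma divisible_by_quadratic gens m v : (forall u, u \in gens -> mdeg u = 2%N) ->
    divisible_by gens (m + U_(v))%MM ->
  divisible_by gens m \/ exists2 u, (0 < m u)%N & divisible_by gens (U_(u) + U_(v))%MM.
Proof.
move=> g2 /hasP[g gS le]; have [lem|nle] := boolP (g <= m)%MM.
  by left; apply/hasP; exists g.
right; have gv : (0 < g v)%N.
  rewrite lt0n; apply: contraNneq nle => gv; apply/mnm_lepP=> i.
  move/mnm_lepP/(_ i): le; rewrite mnmDE mnm1E; case: eqP => [<-|_]; last by rewrite addn0.
  by rewrite gv.
have : mdeg (g - U_(v))%MM == 1%N by have := mdeg_subU gv; rewrite g2 // => -[<-].
case/mdeg1P=> u /eqP gu; exists u.
  move/mnm_lepP/(_ u): le; have : g u = (U_(u) + U_(v))%MM u.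
    by rewrite -gu submK // lem_mnm1.
  by move=> ->; rewrite !mnmDE leq_add2r mnm1E eqxx.
apply/hasP; exists g => //; rewrite -gu submK ?lem_mnm1 //; exact: lepm_refl.
Qed.

Lemma ideal_gen_monomials gens (f : {mpoly K[n]}) :
  ideal_gen [seq 'X_[K, u] | u <- gens] f <->
  forall m, f@_m != 0 -> divisible_by gens m.
Proof.
set s := [seq _ | u <- gens].
have nth_s (i : nat) : (i < size s)%N -> s`_i = 'X_[K, nth 0%MM gens i].
  by rewrite size_map => lt; rewrite (nth_map 0%MM).
split=> [[c ->] m|H].
  rewrite raddf_sum => nz.
  have [i nzi] : exists i : 'I_(size s), (c i * s`_i)@_m != 0.
    apply/existsP; apply: contraNT nz; rewrite negb_exists => /forallP z.
    by apply/eqP/big1 => i _; apply/eqP; have := z i; rewrite negbK.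
  apply/hasP; exists (nth 0%MM gens i).
    by rewrite mem_nth // -(size_map (fun u => 'X_[K, u])).
  by move: nzi; rewrite nth_s // mulrC mcoeffXM; case: ifP => //; rewrite eqxx.
have gen0 : ideal_gen s 0 by exists (fun=> 0); rewrite big1 // => i _; rewrite mul0r.
have genD g h : ideal_gen s g -> ideal_gen s h -> ideal_gen s (g + h).
  move=> [c ->] [c' ->]; exists (fun i => c i + c' i).
  by rewrite -big_split; apply: eq_bigr => i _; rewrite mulrDl.
rewrite [f]mpolyE big_seq; elim/big_ind: _ => // m; rewrite mcoeff_msupp => /H.
case/hasP=> u ug le.
have lt : (index 'X_[K, u] s < size s)%N by rewrite index_mem; apply/mapP; exists u.
exists (fun i => if i == Ordinal lt then f@_m *: 'X_[m - u] else 0).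
rewrite (bigD1 (Ordinal lt)) //= eqxx big1 => [|i /negbTE ->]; last by rewrite mul0r.
rewrite addr0 nth_index; last by apply/mapP; exists u.
by rewrite -scalerAl -mpolyXD submK.
Qed.

End MonomialGenerators.

(** * Betti numbers as Koszul homology of the quotient ring *)

Section AugmentedResolution.

Variables (K : fieldType) (n : nat) (I : {mpoly K[n]} -> Prop).
Variable F : graded_free_resolution I.
Local Notation R := {mpoly K[n]}.

(* The resolution of [R/I] obtained from [F] by inserting [R] in homological degree
   [0], so that all indices are raised by one. *)
Definition aug_rank i := if i is i'.+1 then gfr_rank F i' else 1%N.

Definition aug_shift i : 'I_(aug_rank i) -> nat :=
  match i with 0 => fun _ => 0%N | i'.+1 => @gfr_shift K n I F i' end.

Definition aug_diff i : 'M[R]_(aug_rank i.+1, aug_rank i) :=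
  match i with 0 => gfr_aug F | i'.+1 => gfr_diff F i' end.

Definition aug_map i : {linear 'rV[R]_(aug_rank i.+1) -> 'rV[R]_(aug_rank i)} :=
  mulmxr (aug_diff i).

Lemma aug_exact i (v : 'rV[R]_(aug_rank i.+1)) :
  aug_map i v = 0 <-> exists w, v = aug_map i.+1 w.
Proof. by case: i v => [|i] v; [apply: gfr_exact0 | apply: gfr_exactS]. Qed.

Lemma aug_diff_degree i a c m :
  (aug_diff i a c)@_m != 0 -> (mdeg m + aug_shift c = aug_shift a)%N.
Proof.
rewrite -mcoeff_msupp; case: i a c => [|i] a c ms.
  rewrite /= ord1 in ms *; rewrite addn0.
  by have /dhomogP := @gfr_aug_graded _ _ _ F a; apply.
have := @gfr_diff_graded _ _ _ F i a c; rewrite /graded_entry.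
case: leqP => [le /dhomogP/(_ m ms) /= -> | _ /eqP g0]; first by rewrite subnK.
by rewrite /= g0 msupp0 in ms.
Qed.

Lemma aug_degree i k j (x : 'rV[R]_(aug_rank i.+1)) :
  degree_part (cs := row_coefs K n (aug_rank i)) j
    (fun a => k + @aug_shift i a)%N (aug_map i x) =
  aug_map i (degree_part (cs := row_coefs K n (aug_rank i.+1)) j
    (fun a => k + @aug_shift i.+1 a)%N x).
Proof.
apply: row_coef_inj => c m.
rewrite [LHS](coef_degree_part (cs := row_coefs K n (aug_rank i))) /=.
rewrite /row_coef !mxE !raddf_sum /= -[if _ then _ else _]mulrb -sumrMnl.
apply: eq_bigr => a _; rewrite !mcoeffM -sumrMnl; apply: eq_bigr => b /eqP mb.
have [->|nz] := eqVneq ((aug_diff i a c)@_(b.2)) 0; first by rewrite !mulr0 mul0rn.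
have := coef_degree_part (cs := row_coefs K n (aug_rank i.+1)) j
  (fun a => k + @aug_shift i.+1 a)%N x a b.1.
rewrite /= /row_coef => ->.
have : (mdeg b.2 + aug_shift c = gfr_shift a)%N := aug_diff_degree nz.
have := congr1 mdeg mb; rewrite mdegD => em <-.
have -> : (mdeg m + (k + aug_shift c) = mdeg b.1 + (k + (mdeg b.2 + aug_shift c)))%N.
  apply: etrans (congr1 (addn^~ _) em) _; rewrite -addnA; congr (_ + _)%N.
  by rewrite addnCA.
by case: eqP; rewrite ?mulr1n ?mulr0n ?mul0r.
Qed.

Lemma aug_image (x : 'rV[R]_1) : (exists y, x = aug_map 0 y) <-> I (x 0 0).
Proof.
rewrite gfr_aug_image; split=> -[y e]; exists y; first by rewrite e.
by apply/rowP=> a; rewrite ord1.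
Qed.

Hypothesis F_minimal : minimal_resolution F.
Variable mon : pred 'X_{1..n}.
Hypothesis I_mon : forall f, I f <-> forall m, f@_m != 0 -> mon m.
Hypothesis mon0 : ~~ mon 0%MM.

(** Minimality of [F] covers positive indices. The entries at index [0] lie in [I], whose elements
    have no constant term by [mon0]. *)
Lemma aug_diff_minimal i a c : (aug_diff i a c)@_0%MM = 0.
Proof.
case: i a c => [|i] a c; last exact: F_minimal.
have [//|nz] := eqVneq ((aug_diff 0 a c)@_0%MM) 0; case/negP: mon0.
apply: (proj1 (I_mon (aug_diff 0 a c))) nz; apply/gfr_aug_image.
by exists (delta_mx 0 a); rewrite -rowE mxE ord1.
Qed.

Lemma aug_minimal i (x : 'rV[R]_(aug_rank i.+1)) a : row_coef a 0%MM (aug_map i x) = 0.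
Proof.
rewrite /row_coef mxE raddf_sum big1 //= => c _.
by rewrite rmorphM /= aug_diff_minimal mulr0.
Qed.

(** This is the symmetry of Tor: generators at step [i.+1] of the resolution of [R/I] are traded, by
    dimension shifting, for Koszul homology of [R/I] in degree [i.+1]. *)
Lemma betti_homology i j :
  betti F i j <> 0%N <-> exists2 b, mdeg b = j & homology_nonzero K mon i.+1 b.
Proof.
pose cs i := row_coefs K n (aug_rank i).
have -> : betti F i j <> 0%N <-> exists a : 'I_(aug_rank i.+1), @aug_shift i.+1 a = j.
  rewrite /betti; split.
    by move/eqP; rewrite -lt0n => /card_gt0P[a]; rewrite inE => /eqP; exists a.
  by case=> a aj; apply/eqP; rewrite -lt0n; apply/card_gt0P; exists a; rewrite inE; apply/eqP.
have S0 := @syzygy_homology0 K n _ _ _ cs aug_map aug_shift aug_minimal i.+1 j.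
have Sh := @syzygy_homology_shift K n _ _ _ cs aug_map aug_shift aug_exact aug_degree aug_minimal
  0 i.+1 j.
rewrite addn0 in Sh.
have im x : (exists y, x = aug_map 0 y) <-> forall m, cs_coef (cs 0) 0 m x != 0 -> mon m.
  by rewrite aug_image I_mon.
have o1 (a : cs_index (cs 0)) : a = 0 by rewrite ord1.
have s0 : @aug_shift 0 0 = 0%N by [].
split=> [/S0/Sh H|[b bj Hb]].
  exact: (@syzygy_strand_homology K n _ _ _ cs aug_map aug_shift mon 0 s0 im _ _ H).
apply/S0/Sh; rewrite -bj.
exact: (@strand_homology_syzygy K n _ _ _ cs aug_map aug_shift mon 0 o1 s0 im _ _ Hb).
Qed.

End AugmentedResolution.

(** * Strict growth of the first indices *)

Lemma head_filter_iota1 (P : pred nat) p :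
  let i0 := head 0%N [seq i <- iota 1 p | P i] in
  (forall i, (0 < i <= p)%N -> P i -> (0 < i0 <= i)%N /\ P i0) /\ (i0 <= p)%N.
Proof.
set i0 := head _ _.
have mem : [seq i <- iota 1 p | P i] != [::] -> [/\ P i0, (0 < i0)%N & (i0 <= p)%N].
  move=> ne; have : i0 \in [seq i <- iota 1 p | P i].
    by rewrite /i0; case: [seq _ <- _ | _] ne => // a l _; rewrite mem_head.
  by rewrite mem_filter mem_iota add1n ltnS => /and3P[].
split=> [i ip Pi|]; last first.
  by have [e|/mem[]//] := eqVneq [seq i <- iota 1 p | P i] [::]; rewrite /i0 e.
have iin : i \in [seq i <- iota 1 p | P i] by rewrite mem_filter Pi mem_iota add1n ltnS.
have [|Pi0 i00 _] := mem; first by apply: contraTneq iin => ->.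
split=> //; rewrite i00 /=.
have : sorted leq [seq i <- iota 1 p | P i].
  exact: (sorted_filter leq_trans) (iota_sorted 1 p).
rewrite /i0; case: [seq _ <- _ | _] iin => //= a l; rewrite inE => /orP[/eqP -> //|il].
by rewrite (path_sortedE leq_trans) => /andP[/allP/(_ i il)].
Qed.

Local Close Scope ring_scope.

Theorem theorem5p2 (K : fieldType) (n : nat) (I : {mpoly K[n]} -> Prop)
    (hI : generated_by_quadratic_monomials I)
    (F : graded_free_resolution I) (hF : minimal_resolution F)
    (m : nat) (hm : castelnuovo_mumford_regularity F m)
    (p : nat) (hp : resolution_length F p)
    (hlin : ~ linear_resolution F) :
  [/\ 1 <= first_index F p 3,
      (forall d, 3 <= d < m -> first_index F p d < first_index F p d.+1)
    & first_index F p m <= p].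
Proof.
case: hI => gens g2 Igen; pose mon := divisible_by gens.
have I_mon f : I f <-> forall u, (f@_u != 0)%R -> mon u.
  by rewrite Igen; apply: ideal_gen_monomials.
have mon0 : ~~ mon 0%MM by apply: divisible_by_mdeg g2 _; rewrite mdeg0.
have mon1 v : ~~ mon U_(v)%MM by apply: divisible_by_mdeg g2 _; rewrite mdeg1.
have mon_id : monomial_ideal mon := @divisible_by_ideal n gens.
have mon2 u v := @divisible_by_quadratic n gens u v g2.
have bettiP := betti_homology hF I_mon mon0.
have betti_ge i j : betti F i j <> 0%N -> (i + 2 <= j)%N.
  by case/bettiP=> b <- /(homology_lt_mdeg mon1 (ltn0Sn i)); lia.
(* With [k = i.+1], the degree [i + d] is [k + d.-1], so the strand bound is applied to [d.-1]. *)
have betti_le i d : betti F i (i + d) <> 0%N -> (d <= i + 2)%N.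
  case: d => [|d] // /bettiP[b bj Hb].
  by have := homology_strand_le mon_id mon2 (r := d) Hb; lia.
(* The condition on [d] makes the strand number [d.-1] positive, so the strand bound gives [k' > 0]
   and [i' = k'.-1] is a genuine index. *)
have descend i d : (1 < d)%N -> betti F i (i + d.+1) <> 0%N ->
    exists2 i', (i' < i)%N & betti F i' (i' + d) <> 0%N.
  case: d => // r r1 /bettiP[b bj Hb].
  have [|k' [b' [H' b'j lt]]] := homology_descend mon_id mon2 (r := r) Hb; first by lia.
  have := homology_strand_le mon_id mon2 H' b'j.
  case: k' H' b'j lt => [|i'] H' b'j lt le; first by lia.
  by exists i' => //; apply/bettiP; exists b' => //; lia.
have betti_range i d : (2 < d)%N -> betti F i (i + d) <> 0%N -> (0 < i <= p)%N.
  move=> d3 Hb; have := betti_le _ _ Hb; case: (leqP i p) => [|lt _]; first by lia.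
  by case: Hb; rewrite /betti; apply: eq_card0 => -[a la]; exfalso; move: la; rewrite (hp.2 i lt).
(* Otherwise [betti_ge] and the regularity bound leave only [j = i + 2], a linear resolution. *)
have m3 : (2 < m)%N.
  apply: NNPP => nm; apply: hlin => i j nj; apply: NNPP => Hb.
  have ge := betti_ge _ _ Hb; have := hm.2 i (j - i)%N; rewrite subnKC; last by lia.
  by move/(_ Hb); lia.
(* Descending from the regularity reaches every [d] from [m] down to [3], so the default value [0]
   of [first_index] never occurs there. *)
have nonzero e : (e <= m - 3)%N -> exists i, betti F i (i + (m - e)) <> 0%N.
  elim: e => [|e IH] le; first by rewrite subn0; case: hm.
  have [|i] := IH; first by lia.
  rewrite (_ : (m - e = (m - e.+1).+1)%N); last by lia.
  by case/descend=> [|i' _ Hb]; [lia | exists i'].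
have first_betti d : (2 < d <= m)%N -> betti F (first_index F p d) (first_index F p d + d) <> 0%N.
  move=> dm; have [|i] := nonzero (m - d)%N; first by lia.
  rewrite subKn; last by lia.
  move=> Hb; have ip : (0 < i <= p)%N by apply: betti_range Hb; lia.
  have [H _] := head_filter_iota1 (fun i => betti F i (i + d) != 0) p.
  by have [_ /eqP] := H i ip (introN eqP Hb).
split; last exact: (head_filter_iota1 _ p).2.
  by have /andP[] := betti_range _ 3 isT (first_betti 3 m3).
move=> d dm; have d1 : 1 < d by lia.
(* Descent from the first index for [d.+1] yields a strictly smaller index for [d], and the first
   one for [d] is no larger. *)
have [|i' lt Hb] := descend _ d d1 (first_betti d.+1 _); first by lia.
apply: leq_ltn_trans lt; have ip : (0 < i' <= p)%N by apply: betti_range Hb; lia.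
have [H _] := head_filter_iota1 (fun i => betti F i (i + d) != 0) p.
by have [/andP[]] := H i' ip (introN eqP Hb).
Qed.
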